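(* Let $\mathbf{B}$ be a bounding family on $[n]^d$ with induced quasimetric $\mathfrak{m}$, and let $\mathcal{D}=\prod_{r=1}^d\mathcal{D}_r$ be a product distribution on $[n]^d$ with $\mu_{\mathcal{D}_r}(j)=q_r(j)/N$ for positive integers $q_r(j)$ and $N$. Let $\Phi:[N]^d\to[n]^d$, $f_{\mathrm{ext}}$ and $\mathfrak{m}_{\mathrm{ext}}$ be as in the context, and let $p\ge1$. Let $f:[n]^d\to\mathbb{R}$, let $g\in\mathcal{P}(\mathbf{B})$ minimize $\mathbf{E}_{x\sim\mathcal{D}}[|f(x)-g(x)|^p]$ over $\mathcal{P}(\mathbf{B})$, let $g_{\mathrm{ext}}=g\circ\Phi$, and let $g'_{\mathrm{ext}}:[N]^d\to\mathbb{R}$ minimize $\mathbf{E}_{v\sim\mathcal{U}}[|f_{\mathrm{ext}}(v)-h(v)|^p]$ over all $h:[N]^d\to\mathbb{R}$ satisfying $h(v)-h(w)\le\mathfrak{m}_{\mathrm{ext}}(v,w)$ for all $v,w\in[N]^d$. Then $$\left(\mathbf{E}_{x\sim\mathcal{D}}[|f-g|^p]\right)^{1/p}=\left(\mathbf{E}_{v\sim\mathcal{U}}[|f_{\mathrm{ext}}-g_{\mathrm{ext}}|^p]\right)^{1/p}=\left(\mathbf{E}_{v\sim\mathcal{U}}[|f_{\mathrm{ext}}-g'_{\mathrm{ext}}|^p]\right)^{1/p},$$ where $\mathcal{U}$ is the uniform distribution on $[N]^d$.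
   Context: A bounding family is $l_1,u_1,\dots,l_d,u_d:[n-1]\to\mathbb{R}$ with $l_r<u_r$ pointwise; $\mathcal{P}(\mathbf{B})$ is the set of $f:[n]^d\to\mathbb{R}$ with $l_r(x_r)\le f(x+\mathbf{e}_r)-f(x)\le u_r(x_r)$ for all $r$ and $x$ with $x_r\le n-1$. The induced quasimetric is $\mathfrak{m}(x,y)=\sum_{r:x_r>y_r}\sum_{t=y_r}^{x_r-1}u_r(t)-\sum_{r:x_r<y_r}\sum_{t=x_r}^{y_r-1}l_r(t)$. For each $r$, partition $[N]$ into $n$ consecutive segments of lengths $q_r(1),\dots,q_r(n)$ and let $\phi_r(t)$ be the index of the segment containing $t$; set $\Phi(x_1,\dots,x_d)=(\phi_1(x_1),\dots,\phi_d(x_d))$. Define $f_{\mathrm{ext}}=f\circ\Phi$ and $\mathfrak{m}_{\mathrm{ext}}(v,w)=\mathfrak{m}(\Phi(v),\Phi(w))$ for $v,w\in[N]^d$. *)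

(* Defs.v *)
From HB Require Import structures.
From mathcomp Require Import all_boot all_order all_algebra.
From mathcomp Require Import reals exp.
Set Implicit Arguments.
Unset Strict Implicit.
Unset Printing Implicit Defensive.
Import Order.TTheory GRing.Theory Num.Theory.
Local Open Scope ring_scope.

(* All index sets are 0-based: [n] is 'I_n, and [n-1] is 'I_n.-1, the element
   t : 'I_n.-1 standing for the step from t to t.+1. *)
Notation grid n d := {ffun 'I_d -> 'I_n}.

Record bounding_family (R : realType) (n d : nat) := BoundingFamily {
  lower : 'I_d -> 'I_n.-1 -> R ;
  upper : 'I_d -> 'I_n.-1 -> R ;
  lower_lt_upper : forall r t, lower r t < upper r t }.

(* y = x + e_r, as a relation: such a y : grid n d exists iff x r is not the
   last element of 'I_n. *)
Definition is_succ (n d : nat) (r : 'I_d) (x y : grid n d) : Prop :=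
  forall s, y s = (x s + (s == r))%N :> nat.

Definition bounded_derivative (R : realType) (n d : nat)
    (B : bounding_family R n d) (f : grid n d -> R) : Prop :=
  forall (r : 'I_d) (x y : grid n d) (t : 'I_n.-1),
    x r = t :> nat -> is_succ r x y ->
    lower B r t <= f y - f x <= upper B r t.

Definition quasimetric (R : realType) (n d : nat)
    (B : bounding_family R n d) (x y : grid n d) : R :=
  \sum_(r < d | (y r < x r)%N) \sum_(t < n.-1 | (y r <= t < x r)%N) upper B r t
  - \sum_(r < d | (x r < y r)%N)
      \sum_(t < n.-1 | (x r <= t < y r)%N) lower B r t.

Definition is_distribution (R : realType) (T : finType) (mu : T -> R) : Prop :=
  (forall x, 0 <= mu x) /\ \sum_x mu x = 1.

Definition product_distribution (R : realType) (n d : nat)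
    (mu : 'I_d -> 'I_n -> R) (x : grid n d) : R := \prod_r mu r (x r).

Definition uniform_distribution (R : realType) (T : finType) (_ : T) : R :=
  #|T|%:R^-1.

Definition expectation (R : realType) (T : finType) (mu F : T -> R) : R :=
  \sum_x mu x * F x.

Definition is_minimizer (R : realType) (X : Type) (C : X -> Prop)
    (cost : X -> R) (g : X) : Prop :=
  C g /\ forall h, C h -> cost g <= cost h.

(* When 'I_N is cut into consecutive segments of lengths q 0, ..., q (n-1),
   phi t is the index of the segment containing t. *)
Definition is_segment_index (n N : nat) (q : 'I_n -> nat)
    (phi : 'I_N -> 'I_n) : Prop :=
  forall t, (\sum_(i < n | (i < phi t)%N) q i <= t
               < \sum_(i < n | (i <= phi t)%N) q i)%N.

Definition grid_map (n N d : nat) (phi : 'I_d -> 'I_N -> 'I_n)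
    (v : grid N d) : grid n d := [ffun r => phi r (v r)].

(* Main.v *)
(* A function h with h v - h w <= mext v w is constant on the fibres of Phi,
   because the quasimetric vanishes on the diagonal. It therefore descends to
   the small grid, where the quasimetric constraint is equivalent to the bounds
   on the derivatives. As Phi pushes the uniform distribution forward to D, the
   two minimization problems have the same feasible functions and costs. *)
Require Import Defs.
From HB Require Import structures.
From mathcomp Require Import all_boot all_order all_algebra.
From mathcomp Require Import zify lra.
From mathcomp Require Import reals exp.
Import Order.TTheory GRing.Theory Num.Theory.
Local Open Scope ring_scope.

(** * Sums over intervals of indices *)

Lemma big_ord_cat (V : Type) (idx : V) (op : Monoid.com_law idx) (m : nat)
    (F : 'I_m -> V) (a c b : nat) :
  (a <= c)%N -> (c <= b)%N ->
  \big[op/idx]_(t < m | (a <= t < b)%N) F t =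
  op (\big[op/idx]_(t < m | (a <= t < c)%N) F t)
     (\big[op/idx]_(t < m | (c <= t < b)%N) F t).
Proof.
move=> ac cb; rewrite (bigID (fun t : 'I_m => (t < c)%N)) /=.
by congr (op _ _); apply: eq_bigl => t; lia.
Qed.

Lemma big_ord_empty (V : Type) (idx : V) (op : V -> V -> V) (m : nat)
    (F : 'I_m -> V) (a b : nat) :
  (b <= a)%N -> \big[op/idx]_(t < m | (a <= t < b)%N) F t = idx.
Proof. by move=> ba; rewrite big_pred0 // => t; lia. Qed.

Lemma big_ord_single (V : Type) (idx : V) (op : Monoid.law idx) (m : nat)
    (F : 'I_m -> V) (t : 'I_m) :
  \big[op/idx]_(s < m | (t <= s < t.+1)%N) F s = F t.
Proof.
rewrite (big_pred1 t) // => s.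
by rewrite ltnS andbC -eqn_leq.
Qed.

(** * The quasimetric and its one-step constraints *)

Section Quasimetric.
Variables (R : realType) (n d : nat) (B : bounding_family R n d).
Implicit Types (x y z : grid n d) (r : 'I_d).

(** The contribution of one coordinate. No case split on the order of [a] and [b] is needed: at
    least one of the two ranges is empty. *)
Let coord r (a b : nat) : R :=
  \sum_(t < n.-1 | (b <= t < a)%N) upper B r t
  - \sum_(t < n.-1 | (a <= t < b)%N) lower B r t.

Let quasimetric_coord x y : quasimetric B x y = \sum_r coord r (x r) (y r).
Proof.
rewrite /quasimetric /coord sumrB; congr (_ - _); rewrite big_mkcond;
  by apply: eq_bigr => r _; case: ifPn => //; rewrite -leqNgt => ?;
    rewrite big_ord_empty.
Qed.

Lemma quasimetricxx x : quasimetric B x x = 0.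
Proof.
rewrite quasimetric_coord big1 // => r _.
by rewrite /coord !big_ord_empty ?subrr.
Qed.

(** Equality case of the triangle inequality: on a monotone passage through [z] each coordinate uses
    only [upper] or only [lower], and its range of steps splits at [z r]. *)
Lemma quasimetric_between x z y :
  (forall r, (x r <= z r <= y r)%N || (y r <= z r <= x r)%N) ->
  quasimetric B x y = quasimetric B x z + quasimetric B z y.
Proof.
move=> btw; rewrite !quasimetric_coord -big_split /=; apply: eq_bigr => r _.
rewrite /coord; case/orP: (btw r) => /andP[h1 h2].
  rewrite !(@big_ord_empty _ _ _ _ (upper B r)) //; last exact: leq_trans h2.
  by rewrite (big_ord_cat _ _ _ _ _ _ _ _ h1 h2) /=; lra.
rewrite !(@big_ord_empty _ _ _ _ (lower B r)) //; last exact: leq_trans h2.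
by rewrite (big_ord_cat _ _ _ _ _ _ _ _ h1 h2) /=; lra.
Qed.

Lemma quasimetric_succ r x y (t : 'I_n.-1) : x r = t :> nat -> is_succ r x y ->
  quasimetric B y x = upper B r t /\ quasimetric B x y = - lower B r t.
Proof.
move=> xrt sxy; have yrt : y r = t.+1 :> nat by rewrite sxy eqxx xrt addn1.
have off s : s != r -> y s = x s :> nat.
  by move=> sr; rewrite sxy (negPf sr) addn0.
split; rewrite quasimetric_coord (bigD1 r) //= big1 ?addr0;
  try by move=> s /off e; rewrite /coord e !big_ord_empty ?subrr.
- by rewrite /coord xrt yrt big_ord_single big_ord_empty ?subr0.
- by rewrite /coord xrt yrt big_ord_single big_ord_empty ?sub0r.
Qed.

Lemma exists_succ r x : ((x r).+1 < n)%N -> exists y, is_succ r x y.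
Proof.
move=> kn; exists [ffun s => if s == r then Ordinal kn else x s] => s.
by rewrite ffunE; case: eqP => [->|_] /=; rewrite ?addn1 ?addn0.
Qed.

Lemma exists_pred r x : (0 < x r)%N -> exists y, is_succ r y x.
Proof.
move=> x_gt0; have kn : ((x r).-1 < n)%N by have := ltn_ord (x r); lia.
exists [ffun s => if s == r then Ordinal kn else x s] => s.
by rewrite ffunE; case: eqP => [->|_] /=; rewrite ?addn0 // addn1 prednK.
Qed.

(** Between neighbours the quasimetric inequalities in the two directions are exactly the two
    derivative bounds. Conversely, walk from [x] to [y] by unit steps inside the box they span; the
    bounds along the walk add up to the quasimetric. *)
Lemma bounded_derivative_quasimetric (f : grid n d -> R) :
  bounded_derivative B f <-> forall x y, f x - f y <= quasimetric B x y.
Proof.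
split=> [bf | qf r x y t xrt sxy]; last first.
  have [e1 e2] := quasimetric_succ _ _ _ _ xrt sxy.
  by have := qf x y; have := qf y x; rewrite e1 e2; lra.
move=> x y.
(* Since subtraction is truncated, one term in each summand vanishes and the sum is the l1 distance
   from [x] to [y]. *)
have [k] := ubnP (\sum_r ((x r - y r) + (y r - x r)))%N.
elim: k x => // k IH x lek.
case: (pickP (fun r => x r != y r)) => [r nxy | exy]; last first.
  have -> : x = y by apply/ffunP => r; apply/eqP/negbFE/exy.
  by rewrite quasimetricxx subrr.
(* It suffices to find a first step [z] towards [y] that moves coordinate [r]: this coordinate gets
   strictly closer and no other gets farther. *)
have step z : f x - f z <= quasimetric B x z -> z r != x r ->
    (forall s, (x s <= z s <= y s)%N || (y s <= z s <= x s)%N) ->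
    f x - f y <= quasimetric B x y.
  move=> fz zr btw; rewrite (quasimetric_between x z y btw).
  suff /IH : (\sum_r ((z r - y r) + (y r - z r)) < k)%N by lra.
  rewrite ltnS in lek; apply: leq_trans lek.
  rewrite [ltnLHS](bigD1 r) // [leqRHS](bigD1 r) //=.
  rewrite -addSn leq_add //; last by apply: leq_sum => s _; have := btw s; lia.
  by move: zr (btw r); rewrite -val_eqE /=; lia.
case: (ltngtP (x r) (y r)) => [xy | yx | /val_inj xy];
  last by rewrite xy eqxx in nxy.
  have tn : (x r < n.-1)%N by have := ltn_ord (y r); lia.
  have [|z sxz] := exists_succ r x; first by lia.
  apply: (step z).
  - have [_ ->] := quasimetric_succ _ _ _ (Ordinal tn) erefl sxz.
    by have := bf r x z (Ordinal tn) erefl sxz; lra.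
  - by rewrite -val_eqE /= sxz eqxx; lia.
  - by move=> s; rewrite sxz; case: eqP => [->|_] /=; lia.
(* For a downward move the step is indexed by its lower end [z r], and it is the upper bound that
   applies. *)
have [|z szx] := exists_pred r x; first by lia.
have zx : x r = (z r).+1 :> nat by rewrite szx eqxx addn1.
have tn : (z r < n.-1)%N by have := ltn_ord (x r); lia.
apply: (step z).
- have [-> _] := quasimetric_succ _ _ _ (Ordinal tn) erefl szx.
  by have := bf r z x (Ordinal tn) erefl szx; lra.
- by rewrite -val_eqE /=; lia.
- by move=> s; have := szx s; case: eqP => [->|_] /=; lia.
Qed.
End Quasimetric.

(** * Fibre sizes and the push-forward of the uniform distribution *)

Lemma card_ord_interval (N a b : nat) : (a <= b)%N -> (b <= N)%N ->
  #|[pred t : 'I_N | (a <= t < b)%N]| = (b - a)%N.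
Proof.
rewrite -sum1_card; elim: b => [|b IH].
  by rewrite leqn0 => /eqP-> _; rewrite big_ord_empty.
rewrite leq_eqVlt => /predU1P[-> _ | ab bN].
  by rewrite big_ord_empty ?subnn.
rewrite (@big_ord_cat _ _ _ _ _ a b) //= IH //; last exact: ltnW.
by rewrite (big_ord_single _ _ _ _ _ (Ordinal bN)) subSn // addn1.
Qed.

(** With prefix sums [S], the fibre over [j] is the interval from [S j] to [S j.+1], as monotonicity
    of [S] keeps segments disjoint. The bound on the total ensures that [N] does not truncate it. *)
Lemma card_segment (n N : nat) (q : 'I_n -> nat) (phi : 'I_N -> 'I_n)
    (j : 'I_n) :
  is_segment_index q phi -> (\sum_i q i <= N)%N ->
  #|[pred t | phi t == j]| = q j.
Proof.
move=> seg qN; pose S k := (\sum_(i < n | (0 <= i < k)%N) q i)%N.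
have S_mono a b : (a <= b)%N -> (S a <= S b)%N.
  by move=> ab; rewrite /S [leqRHS](@big_ord_cat _ _ _ _ _ 0 a) //= leq_addr.
have SS : S j.+1 = (S j + q j)%N.
  by rewrite /S (@big_ord_cat _ _ _ _ _ 0 j) //= big_ord_single.
have SN : (S j.+1 <= N)%N.
  apply: leq_trans qN; rewrite [leqRHS](bigID (fun i : 'I_n => (i < j.+1)%N)) /=.
  exact: leq_addr.
rewrite -[RHS](addKn (S j)) -SS -(card_ord_interval N) ?S_mono //.
apply: eq_card => t; rewrite !inE.
have segt : (S (phi t) <= t < S (phi t).+1)%N := seg t.
case: (ltngtP (phi t) j) => [lt | gt | /val_inj eq].
- have := S_mono _ _ lt; rewrite -val_eqE /=; lia.
- have := S_mono _ _ gt; rewrite -val_eqE /=; lia.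
- by rewrite eq eqxx -eq segt.
Qed.

Lemma card_grid_map_fiber (n N d : nat) (phi : 'I_d -> 'I_N -> 'I_n)
    (x : grid n d) :
  #|[pred v | grid_map phi v == x]| = (\prod_r #|[pred t | phi r t == x r]|)%N.
Proof.
have -> : #|[pred v | grid_map phi v == x]|
    = #|family (fun r => [pred t | phi r t == x r])|.
  apply: eq_card => v; rewrite inE; apply/eqP/familyP => [<- r | vx].
    by rewrite inE ffunE.
  by apply/ffunP => r; rewrite ffunE; apply/eqP; have := vx r; rewrite inE.
by rewrite card_family foldrE big_map big_enum.
Qed.

(** Fibres are products of coordinate fibres, so the one over [x] has [N ^ d] times the mass of [x]
    many points, each of uniform weight [N ^ -d]. *)
Lemma expectation_grid_map (R : realType) (n N d : nat)
    (mu : 'I_d -> 'I_n -> R) (phi : 'I_d -> 'I_N -> 'I_n) (F : grid n d -> R) :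
  (forall r j, mu r j = #|[pred t | phi r t == j]|%:R / N%:R) ->
  expectation (product_distribution mu) F =
  expectation (fun v : grid N d => uniform_distribution R v)
    (F \o grid_map phi).
Proof.
move=> muE; rewrite /expectation /uniform_distribution.
rewrite [RHS](partition_big (grid_map phi) predT) //=.
apply: eq_bigr => x _.
under [RHS]eq_bigr => v /eqP-> do [].
rewrite sumr_const -mulrnAl; congr (_ * _).
rewrite card_grid_map_fiber card_ffun !card_ord /product_distribution.
under eq_bigr => r _ do rewrite muE.
rewrite prodf_div prodr_const card_ord -natr_prod -natrX.
by rewrite -[RHS]mulr_natl.
Qed.

Theorem mainTheorem3 (R : realType) (n d N : nat)
    (B : bounding_family R n d)
    (mu : 'I_d -> 'I_n -> R) (q : 'I_d -> 'I_n -> nat)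
    (mu_distr : forall r, is_distribution (mu r))
    (N_gt0 : (0 < N)%N)
    (q_gt0 : forall r j, (0 < q r j)%N)
    (mu_q : forall r j, mu r j = (q r j)%:R / N%:R)
    (phi : 'I_d -> 'I_N -> 'I_n)
    (phi_seg : forall r, is_segment_index (q r) (phi r))
    (p : R) (p_ge1 : 1 <= p)
    (f g : grid n d -> R) (g'ext : grid N d -> R) :
  let D := product_distribution mu in
  let U := fun v : grid N d => uniform_distribution R v in
  let Phi := grid_map phi in
  let fext := f \o Phi in
  let gext := g \o Phi in
  let mext := fun v w : grid N d => quasimetric B (Phi v) (Phi w) in
  is_minimizer (bounded_derivative B)
    (fun h => expectation D (fun x => `|f x - h x| `^ p)) g ->
  is_minimizer (fun h : grid N d -> R => forall v w, h v - h w <= mext v w)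
    (fun h => expectation U (fun v => `|fext v - h v| `^ p)) g'ext ->
  (expectation D (fun x => `|f x - g x| `^ p)) `^ p^-1
    = (expectation U (fun v => `|fext v - gext v| `^ p)) `^ p^-1
  /\ (expectation U (fun v => `|fext v - gext v| `^ p)) `^ p^-1
    = (expectation U (fun v => `|fext v - g'ext v| `^ p)) `^ p^-1.

Proof.
move=> D U Phi fext gext mext [gP gmin] [g'P g'min].
(* Total mass 1 forces the segments to fill ['I_N]. *)
have sum_q r : (\sum_j q r j)%N = N.
  have [_] := mu_distr r; rewrite (eq_bigr _ (fun j _ => mu_q r j)).
  rewrite -mulr_suml -natr_sum => /(canRL (mulfVK _)).
  by rewrite pnatr_eq0 -lt0n N_gt0 mul1r => /(_ isT)/eqP; rewrite eqr_nat => /eqP.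
have card_phi r j : #|[pred t | phi r t == j]| = q r j.
  by rewrite (@card_segment _ _ (q r)) // sum_q.
have costE h : expectation D (fun x => `|f x - h x| `^ p) =
    expectation U (fun v => `|fext v - (h \o Phi) v| `^ p).
  by rewrite (@expectation_grid_map _ _ _ _ _ phi) // => r j; rewrite card_phi mu_q.
(* Every fibre is nonempty because all segment lengths are positive. *)
have Phi_surj x : exists v, Phi v == x.
  apply/existsP; rewrite -[[exists _, _]]/(~~ pred0b _) -lt0n.
  rewrite card_grid_map_fiber prodn_gt0 // => r.
  by rewrite card_phi.
pose g' x := g'ext (xchoose (Phi_surj x)).
(* Two points of one fibre are at [mext] distance 0 both ways, so the representative chosen in [g']
   is immaterial. *)
have g'E v : g'ext v = g' (Phi v).
  have eqPhi := eqP (xchooseP (Phi_surj (Phi v))).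
  have := g'P v (xchoose (Phi_surj (Phi v))).
  have := g'P (xchoose (Phi_surj (Phi v))) v.
  by rewrite /mext eqPhi quasimetricxx -/(g' (Phi v)); lra.
have g'bd : bounded_derivative B g'.
  apply/bounded_derivative_quasimetric => x y.
  have := g'P (xchoose (Phi_surj x)) (xchoose (Phi_surj y)).
  by rewrite /mext (eqP (xchooseP (Phi_surj x))) (eqP (xchooseP (Phi_surj y))).
split; first by rewrite costE.
(* Each minimizer is compared with the transported other one: [gext] is feasible on the large grid,
   [g'] on the small one. *)
congr (_ `^ _); apply/eqP; rewrite eq_le; apply/andP; split; last first.
  have /bounded_derivative_quasimetric gq := gP.
  by apply: g'min => v w; apply: gq.
have -> : expectation U (fun v => `|fext v - g'ext v| `^ p) =
    expectation D (fun x => `|f x - g' x| `^ p).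
  by rewrite costE; apply: eq_bigr => v _; rewrite g'E.
by rewrite -costE; apply: gmin.
Qed.
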